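(* Let $q\ge5$ and $k\ge2$ be integers. Let $(s^k)_n$ denote the sum of the $k$-th powers of all elements of row $n$ of the hyperbolic Pascal triangle $\mathcal{HPT}_{4,q}$. Let $\mathbf{D}(x)$ be the $(k+2)\times(k+2)$ matrix, with rows and columns indexed by $0,1,\dots,k+1$, given by $\mathbf{D}(x)=\mathbf{P}(x)+\mathbf{Q}$, where: (i) $\mathbf{P}(x)$ has entries $P_{u,u}=-x$ for $0\le u\le k$; $P_{u,j}=(-1)^{j-u+1}\binom{k-u}{j-u}x$ for $0\le u<j\le k$; $P_{u,k+1}=(-1)^{k-u}x$ for $0\le u\le k$; $P_{k+1,k}=(q-5)x$; $P_{k+1,k+1}=-(q-4)x$; and all other entries $0$. (ii) $\mathbf{Q}$ has entries $Q_{u,j}=\delta_{j,u}+\delta_{j,k-u}$ for $0\le u,j\le k$ (with $\delta$ the Kronecker delta); $Q_{u,k+1}=1$ for $1\le u\le k-1$; $Q_{0,k+1}=Q_{k,k+1}=Q_{k+1,k+1}=0$; $Q_{k+1,k}=1$; and $Q_{k+1,j}=0$ for $0\le j\le k-1$. Then the characteristic polynomial $k(x)=\det(x\mathbf{I}-\mathbf{M})$ of the matrix $\mathbf{M}$ defined in the context is $k(x)=(-1)^k\det\mathbf{D}(x)$. Moreover, writing $(x-1)(-1)^k\det\mathbf{D}(x)=\sum_{i=0}^{k+3}p_ix^i$ (a monic polynomial of degree $k+3$), the power sums satisfy the linear recurrence $$\sum_{i=0}^{k+3}p_i\,(s^k)_{n+i}=0\qquad\text{for all } n\ge1.$$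
   Context: The hyperbolic Pascal triangle $\mathcal{HPT}_{4,q}$ ($q\ge5$) is an array of rows of positive integers, each element having a type $A$ or $B$, built as follows. Row $0$ is the single element $1$. Row $1$ consists of two elements $1,1$, both of type $B$. The first and last elements of each row $n\ge 1$ (the wingers) have value $1$ and are regarded as type $B$. Given row $n\ge1$, with elements $x_0,x_1,\dots,x_{s_n-1}$ from left to right, row $n+1$ consists, from left to right, of: a left winger of value $1$ (type $B$); then an element $x_0+x_1$ of type $A$; then, for each $i=1,\dots,s_n-2$ in order, first $q-4$ copies of $x_i$ (if $x_i$ has type $A$) or $q-3$ copies of $x_i$ (if $x_i$ has type $B$), all of these copies having type $B$, followed by an element $x_i+x_{i+1}$ of type $A$; and finally a right winger of value $1$ (type $B$). (For instance row $2$ is $1,2,1$, and row $3$ is $1,3,2,\dots,2,3,1$ with $q-4$ copies of $2$.) Here $s_n$ is the number of elements of row $n$, and $(s^k)_n=\sum_{i=0}^{s_n-1}x_i^k$, the sum being over the elements $x_i$ of row $n$. The matrix $\mathbf{M}=[m_{i,j}]$ is the $(k+2)\times(k+2)$ matrix with rows and columns indexed by $0,1,\dots,k+1$ and entries: $m_{i,j}=\binom{k-i}{j}+\binom{k-i}{k-j}$ for $0\le i\le k-1$, $0\le j\le k$; $m_{0,k+1}=2^k-2$; $m_{i,k+1}=2^{k-i}-1$ for $1\le i\le k-1$; $m_{k,0}=q-4$, $m_{k,k}=q-3$, $m_{k+1,0}=q-5$, $m_{k+1,k}=q-4$; all other entries are $0$. A binomial coefficient whose lower index is negative or greater than its upper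 index is $0$. *)

(* Defs.v *)
From mathcomp Require Import all_boot all_order all_algebra.

Set Implicit Arguments.
Unset Strict Implicit.
Unset Printing Implicit Defensive.

Import GRing.Theory.

Inductive vtype := TypeA | TypeB.

Definition hpt_copies (q : nat) (t : vtype) : nat :=
  match t with TypeA => q - 4 | TypeB => q - 3 end.

(* Row n+1 from row n; only meant for rows with at least two elements. *)
Definition hpt_next (q : nat) (s : seq (nat * vtype)) : seq (nat * vtype) :=
  let x i := (nth (0, TypeB) s i).1 in
  let t i := (nth (0, TypeB) s i).2 in
  (1, TypeB) :: (x 0 + x 1, TypeA) ::
  flatten [seq rcons (nseq (hpt_copies q (t i)) (x i, TypeB))
                     (x i + x i.+1, TypeA)
          | i <- iota 1 (size s - 2)]
  ++ [:: (1, TypeB)].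

(* The type given to the single element of row 0 is immaterial: row 1 is
   prescribed explicitly. *)
Fixpoint hpt_row (q n : nat) : seq (nat * vtype) :=
  match n with
  | 0 => [:: (1, TypeB)]
  | 1 => [:: (1, TypeB); (1, TypeB)]
  | m.+1 => hpt_next q (hpt_row q m)
  end.

Definition hpt_psum (q k n : nat) : nat := \sum_(x <- hpt_row q n) x.1 ^ k.

Local Open Scope ring_scope.

Definition hptM (q k : nat) : 'M[int]_k.+2 :=
  \matrix_(i, j)
    if (i < k)%N then
      if (j <= k)%N then ('C(k - i, j) + 'C(k - i, k - j))%:R
      else if (i == 0 :> nat) then 2 ^+ k - 2 else 2 ^+ (k - i) - 1
    else if (i == k :> nat) then
      if (j == 0 :> nat) then q%:R - 4
      else if (j == k :> nat) then q%:R - 3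
      else 0
    else
      if (j == 0 :> nat) then q%:R - 5
      else if (j == k :> nat) then q%:R - 4
      else 0.

(* The variable x of P(x) and D(x) is the indeterminate 'X. *)
Definition hptP (q k : nat) : 'M[{poly int}]_k.+2 :=
  \matrix_(u, j)
    if (u <= k)%N then
      if (j <= k)%N then
        if (u == j :> nat) then - 'X
        else if (u < j)%N then (-1) ^+ (j - u + 1) * 'C(k - u, j - u)%:R * 'X
        else 0
      else (-1) ^+ (k - u) * 'X
    else
      if (j == k :> nat) then (q%:R - 5) * 'X
      else if (j == k.+1 :> nat) then - ((q%:R - 4) * 'X)
      else 0.

Definition hptQ (k : nat) : 'M[{poly int}]_k.+2 :=
  \matrix_(u, j)
    if (u <= k)%N then
      if (j <= k)%N then (j == u :> nat)%:R + (j == k - u :> nat)%N%:R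
      else if (1 <= u <= k - 1)%N then 1 else 0
    else
      if (j == k :> nat) then 1 else 0.

Definition hptD (q k : nat) : 'M[{poly int}]_k.+2 := hptP q k + hptQ k.

(* Main.v *)
Require Import Defs.
From mathcomp Require Import all_boot all_order all_algebra.
From mathcomp Require Import ring zify.

Set Implicit Arguments.
Unset Strict Implicit.
Unset Printing Implicit Defensive.

Import GRing.Theory.
Local Open Scope ring_scope.

(** The determinant identity comes from a unimodular integer matrix G, made of
    binomial coefficients, with G P(x) = - x I and G Q = M (binomial
    inversion), so that G D(x) = M - x I.

    For the recurrence, call two consecutive elements of a row an edge; two
    elements of type A are never consecutive, and two consecutive elements of
    type B are equal. Every edge (x, y) has a son x + y of type A, whose
    neighbours have values x and y. Hence the sums E_j of a^(k-j) b^j over the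
    edges joining an a of type A to a b of type B, together with the sum F of
    b^k over the edges joining equal elements, evolve linearly:
    E_i' is the sum of (x + y)^(k-i) (x^i + y^i) over all edges. Replacing E_k
    by twice the sum of the k-th powers of the elements of type B and doubling
    F gives a state vector V with V' = M V + c and 2 s = V_0 + V_k, where c is
    constant. Cayley-Hamilton then yields the recurrence, c being responsible
    for the factor x - 1. *)

(** * Linear recurrences from the Cayley-Hamilton theorem *)

Lemma horner_mxE (R : comNzRingType) n (A : 'M[R]_n.+1) (p : {poly R}) :
  horner_mx A p = \sum_(i < size p) p`_i *: A ^+ i.
Proof.
rewrite -{1}(coefK p) poly_def rmorph_sum /=; apply: eq_bigr => i _.
by rewrite linearZ /= rmorphXn /= horner_mx_X.
Qed.

(** Since [W (n + i)] is [A ^+ i *m W n], the sum is [char_poly A] evaluated at [A] and applied to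
    [W n]. *)
Lemma char_poly_rec (R : comNzRingType) m (A : 'M[R]_m.+1)
    (W : nat -> 'cV[R]_m.+1) :
  (forall n, W n.+1 = A *m W n) ->
  forall n, \sum_(i < size (char_poly A)) (char_poly A)`_i *: W (n + i)%N = 0.
Proof.
move=> recW n; have WE i : W (n + i)%N = A ^+ i *m W n.
  elim: i => [|i IHi]; first by rewrite addn0 expr0 mul1mx.
  by rewrite addnS recW IHi mulmxA exprS.
transitivity (horner_mx A (char_poly A) *m W n); last first.
  by rewrite Cayley_Hamilton mul0mx.
rewrite horner_mxE mulmx_suml; apply: eq_bigr => i _.
by rewrite -scalemxAl WE.
Qed.

(* The constant term is absorbed by one more coordinate, fixed by the
   recurrence; it accounts for the factor X - 1. *)
Lemma char_poly_affine_rec (R : comNzRingType) m (M : 'M[R]_m) (c : 'cV[R]_m)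
    (V : nat -> 'cV[R]_m) (p := ('X - 1) * char_poly M) :
  (forall n, V n.+1 = M *m V n + c) ->
  forall n, \sum_(i < size p) p`_i *: V (n + i)%N = 0.
Proof.
move=> recV n; pose A : 'M_(1 + m) := block_mx 1%:M 0 c M.
pose W n : 'cV_(1 + m) := col_mx 1%:M (V n).
have recW i : W i.+1 = A *m W i.
  by rewrite /W mul_block_col recV mul1mx mul0mx addr0 mulmx1 addrC.
have pE : p = char_poly A.
  rewrite /p /char_poly /char_poly_mx.
  rewrite (_ : 'X%:M - map_mx polyC A =
    block_mx ('X - 1)%:M 0 (- map_mx polyC c) (char_poly_mx M)).
    by rewrite det_lblock det_scalar1.
  rewrite map_block_mx scalar_mx_block opp_block_mx add_block_mx map_mx0.
  by rewrite oppr0 !add0r map_scalar_mx /= raddfB.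
have := @char_poly_rec _ m A W recW n; rewrite -[char_poly _]pE => sumW0.
transitivity (dsubmx (\sum_(i < size p) p`_i *: W (n + i)%N)).
  by rewrite linear_sum; apply: eq_bigr => i _; rewrite linearZ /= col_mxKd.
by rewrite [X in dsubmx X]sumW0 linear0.
Qed.

(** * Binomial identities *)

(** Terms with v > a vanish with their binomial coefficient, so expansions of different degrees can
    share one range. *)
Lemma exprDn_widen (R : comNzRingType) (x y : R) a m : (a < m)%N ->
  (x + y) ^+ a = \sum_(v < m) x ^+ (a - v) * y ^+ v *+ 'C(a, v).
Proof.
move=> lt_am; rewrite exprDn.
rewrite (big_ord_widen m (fun v => x ^+ (a - v) * y ^+ v *+ 'C(a, v))) //.
rewrite big_mkcond; apply: eq_bigr => v _; case: ltnP => // lt_av.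
by rewrite bin_small.
Qed.

Lemma coef_exprX_sub1 (R : comNzRingType) v c :
  ((-1 + 'X) ^+ v : {poly R})`_c = (-1) ^+ (v - c) * 'C(v, c)%:R.
Proof.
have [lt_cv|le_vc] := ltnP c v.+1; last first.
  rewrite bin_small // mulr0 nth_default //.
  by rewrite addrC -polyC1 size_exp_XsubC.
rewrite exprDn coef_sum (bigD1 (Ordinal lt_cv)) //= big1 ?addr0 => [|i /eqP ne_ic].
  by rewrite coefMn -polyCN -polyC_exp coefCM coefXn eqxx mulr1 mulr_natr.
rewrite coefMn -polyCN -polyC_exp coefCM coefXn.
by case: eqP => [cE|_]; rewrite ?mulr0 ?mul0rn //; case: ne_ic; apply: val_inj.
Qed.

(* Comparison of coefficients in X^a = (1 + (X - 1))^a. *)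
Lemma bin_inversion (R : comNzRingType) a c m : (a < m)%N ->
  \sum_(v < m) 'C(a, v)%:R * ((-1) ^+ (v - c) * 'C(v, c)%:R) = (a == c)%:R :> R.
Proof.
move=> lt_am; transitivity (('X^a : {poly R})`_c); last first.
  by rewrite coefXn eq_sym.
have ->: 'X^a = (1 + (-1 + 'X)) ^+ a :> {poly R} by rewrite addrA subrr add0r.
rewrite (exprDn_widen _ _ lt_am) coef_sum; apply: eq_bigr => v _.
by rewrite expr1n mul1r coefMn coef_exprX_sub1 mulr_natl.
Qed.

Lemma sum_bin_widen (R : comNzRingType) a m : (a < m)%N ->
  \sum_(v < m) 'C(a, v)%:R = 2 ^+ a :> R.
Proof.
move=> lt_am; rewrite -[2]/(1 + 1) (exprDn_widen _ _ lt_am).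
by apply: eq_bigr => v _; rewrite !expr1n mul1r.
Qed.

(** * The unimodular matrix G and the determinant identity *)

(** The block in the last two rows and columns has rows (q-4, 1) and (q-5, 1); its product with the
    same block of [hptP] is [- 'X] times the identity. *)
Definition hptG (q k : nat) : 'M[{poly int}]_k.+2 :=
  \matrix_(i, u)
    if (i < k)%N then
      if (u <= k)%N then 'C(k - i, k - u)%:R else 0
    else if (i == k :> nat) then
      if (u == k :> nat) then q%:R - 4 else (u == k.+1 :> nat)%:R
    else
      if (u == k :> nat) then q%:R - 5 else (u == k.+1 :> nat)%:R.

Definition ord_cmp_facts k :=
  (((k == k.+1) = false) * ((k.+1 == k) = false) * ((k.+1 < k)%N = false)
   * ((k < k)%N = false) * ((k <= k)%N = true) * ((k <= k.+1)%N = true)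
   * ((k == k) = true) * ((k.+1 == k.+1) = true))%type.

(* Each constructor carries, as a rewriting multirule, the truth values of the
   comparisons by which the entries of the matrices are defined. *)
Variant ord_last2_spec k (i : 'I_k.+2) : Type :=
  | OrdLt of (((i < k)%N = true) * ((i <= k)%N = true) * ((k <= i)%N = false)
      * ((i == k :> nat) = false) * ((k == i :> nat) = false) * ((k < i)%N = false)
      * ((i == k.+1 :> nat) = false) * ((k.+1 == i :> nat) = false))%type
  | OrdPenult of ((i = k :> nat) * ord_cmp_facts k)%type
  | OrdLast of ((i = k.+1 :> nat) * ord_cmp_facts k)%type.

Lemma ord_cmpP k : ord_cmp_facts k.
Proof. by do !split; lia. Qed.

Lemma ord_last2P k (i : 'I_k.+2) : ord_last2_spec i.
Proof.
have [lt_ik|lt_ki|Ei] := ltngtP i k.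
- by constructor; do !split; lia.
- constructor 3; split; last exact: ord_cmpP.
  by have := ltn_ord i; lia.
by constructor 2; split; last exact: ord_cmpP.
Qed.

(** G factors as [W *m F] with [W] upper and [F] lower triangular, both with unit diagonal. Right
    multiplication by [F] adds q-5 times the last column to column k, whose index is
    [lift ord_max ord_max]. *)
Lemma det_hptG q k : \det (hptG q k) = 1.
Proof.
pose W : 'M[{poly int}]_k.+2 := \matrix_(i, u)
    if (u <= k)%N then 'C(k - i, k - u)%:R *+ (i <= k)%N else (k <= i)%N%:R.
pose F : 'M[{poly int}]_k.+2 :=
  1%:M + (q%:R - 5) *: delta_mx ord_max (lift ord_max ord_max).
have eq_max (u : 'I_k.+2) : (u == ord_max) = (u == k.+1 :> nat) by [].
have eq_lift (u : 'I_k.+2) : (u == lift ord_max ord_max) = (u == k :> nat).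
  by rewrite -val_eqE /= /bump ltnn.
have ->: hptG q k = W *m F.
  rewrite mulmxDr mulmx1 -scalemxAr; apply/matrixP => i u; rewrite !mxE.
  rewrite (bigD1 ord_max) //= big1 => [|v /negPf nv]; last first.
    by rewrite [delta_mx _ _ v u]mxE nv mulr0.
  rewrite !mxE eqxx eq_lift addr0 andTb /= ltnn.
  case: (ord_last2P i) => Hi; rewrite !Hi ?mul0r ?mulr0 ?addr0 //;
    case: (ord_last2P u) => Hu; rewrite !Hu /= ?mulr0n ?subnn ?bin0;
    rewrite ?bin_small ?subn_gt0 ?Hu //=; ring.
rewrite det_mulmx -[\det W]det_tr !det_trig.
- rewrite !big1 ?mulr1 // => i _; rewrite !mxE.
    rewrite eqxx eq_max eq_lift.
    by case: (ord_last2P i) => Hi; rewrite !Hi ?andbF mulr0 addr0.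
  by case: (ord_last2P i) => Hi; rewrite !Hi ?binn.
- apply/is_trig_mxP => i u lt_iu; rewrite !mxE eq_max eq_lift -val_eqE.
  rewrite (ltn_eqF lt_iu) add0r.
  have -> : (i == k.+1 :> nat) = false by have := ltn_ord u; lia. 
  by rewrite mulr0.
- apply/is_trig_mxP => i u lt_iu; rewrite !mxE.
  have lt_uk := ltn_ord u; case: leqP => [le_ik|lt_ki]; last by exfalso; lia.
  by case: leqP => // le_uk; rewrite bin_small ?mul0rn //; lia.
Qed.

(** Reversing the indices gives the entries the shape required by [bin_inversion], diagonal and zero
    entries included. *)
Lemma hptP_binE q k (u j : 'I_k.+2) : (u <= k)%N -> (j <= k)%N ->
  hptP q k u j = - 'X * ((-1) ^+ ((k - u) - (k - j)) * 'C(k - u, k - j)%:R).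
Proof.
move=> le_uk le_jk; rewrite mxE le_uk le_jk.
have [lt_uj|lt_ju|->] := ltngtP u j; last by rewrite subnn binn !mulr1.
  have -> : (k - u - (k - j) = j - u)%N by lia.
  have -> : 'C(k - u, k - j) = 'C(k - u, j - u).
    by rewrite -bin_sub; [congr ('C(_, _)); lia | lia].
  by rewrite exprD; ring.
by rewrite bin_small ?mulr0 //; lia.
Qed.

Lemma hptG_mul_row q k (B : 'M[{poly int}]_k.+2) (i j : 'I_k.+2) : (i < k)%N ->
  (hptG q k *m B) i j = \sum_(v < k.+1) 'C(k - i, v)%:R * B (inord (k - v)) j.
Proof.
move=> lt_ik; rewrite mxE big_ord_recr /= mxE lt_ik ltnn mul0r addr0.
rewrite (reindex_inj rev_ord_inj); apply: eq_bigr => v _.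
have le_vk : (v <= k)%N by rewrite -ltnS.
rewrite mxE lt_ik /= subSS leq_subr subKn //; congr (_ * B _ j).
by apply: val_inj; rewrite /= inordK ?subSS // ltnS ltnW // ltnS leq_subr.
Qed.

Lemma sum_mul_eq (R : comNzRingType) m c (F : nat -> R) : (c < m)%N ->
  \sum_(v < m) F v * (v == c :> nat)%:R = F c.
Proof.
move=> lt_cm; rewrite (bigD1 (Ordinal lt_cm)) //= eqxx mulr1 big1 ?addr0 // => v.
by rewrite -val_eqE /= => /negPf->; rewrite mulr0.
Qed.

Lemma hptG_P q k : hptG q k *m hptP q k = - 'X%:M.
Proof.
apply/matrixP => i j; rewrite [RHS]mxE [_%:M i j]mxE -val_eqE.
have le_ord (v : 'I_k.+1) : (v <= k)%N by rewrite -ltnS.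
have valk (v : 'I_k.+1) : (inord (k - v) : 'I_k.+2) = (k - v)%N :> nat.
  by rewrite inordK // ltnS ltnW // ltnS leq_subr.
case: (ord_last2P i) => Hi.
- have lt_ik : (i < k)%N by rewrite Hi.
  rewrite hptG_mul_row //.
  have [le_jk|lt_kj] := leqP j k.
    transitivity (- 'X * \sum_(v < k.+1) 'C(k - i, v)%:R *
       ((-1) ^+ (v - (k - j)) * 'C(v, k - j)%:R) : {poly int}).
      rewrite mulr_sumr; apply: eq_bigr => v _.
      by rewrite hptP_binE ?valk ?leq_subr // subKn //; ring.
    rewrite bin_inversion ?ltnS ?leq_subr //.
    have -> : (k - i == k - j)%N = (i == j :> nat) by lia.
    by rewrite mulNr mulr_natr.
  (* In rows up to k the last column of [hptP] is the opposite of column k, so this is again an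
     inversion sum, with c = 0; it vanishes because i < k. *)
  transitivity ('X * \sum_(v < k.+1) 'C(k - i, v)%:R *
       ((-1) ^+ (v - 0) * 'C(v, 0)%:R) : {poly int}).
    rewrite mulr_sumr; apply: eq_bigr => v _.
    rewrite mxE valk leq_subr subKn // leqNgt lt_kj /= subn0 bin0; ring.
  rewrite bin_inversion ?ltnS ?leq_subr //.
  have -> : (i == j :> nat) = false by lia.
  by rewrite subn_eq0 leqNgt lt_ik mulr0 mulr0n oppr0.
- rewrite mxE big_ord_recr big_ord_recr /= big1 => [|u _]; last first.
    have lt_uk := ltn_ord u.
    by rewrite mxE /= !Hi ltn_eqF // ltn_eqF ?mul0r // ltnW.
  rewrite !mxE /= !Hi.
  by case: (ord_last2P j) => Hj; rewrite !Hj /= ?subnn ?expr0; ring.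
rewrite mxE big_ord_recr big_ord_recr /= big1 => [|u _]; last first.
  have lt_uk := ltn_ord u.
  by rewrite mxE /= !Hi ltn_eqF // ltn_eqF ?mul0r // ltnW.
rewrite !mxE /= !Hi.
by case: (ord_last2P j) => Hj; rewrite !Hj /= ?subnn ?expr0; ring.
Qed.

Lemma hptG_Q q k : (0 < k)%N -> hptG q k *m hptQ k = map_mx polyC (hptM q k).
Proof.
move=> k_gt0; apply/matrixP => i j; rewrite [RHS]mxE [hptM q k i j]mxE.
have le_ord (v : 'I_k.+1) : (v <= k)%N by rewrite -ltnS.
have valk (v : 'I_k.+1) : (inord (k - v) : 'I_k.+2) = (k - v)%N :> nat.
  by rewrite inordK // ltnS ltnW // ltnS leq_subr.
case: (ord_last2P i) => Hi.
- have lt_ik : (i < k)%N by rewrite Hi.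
  rewrite hptG_mul_row // Hi.
  have [le_jk|lt_kj] := leqP j k.
    transitivity (\sum_(v < k.+1) 'C(k - i, v)%:R * (v == k - j :> nat)%N%:R
      + \sum_(v < k.+1) 'C(k - i, v)%:R * (v == j :> nat)%:R : {poly int}).
      rewrite -big_split; apply: eq_bigr => v _ /=.
      rewrite mxE valk leq_subr le_jk subKn // -mulrDr; congr (_ * (_%:R + _%:R)).
        have := le_ord v; lia.
      by rewrite eq_sym.
    rewrite !(sum_mul_eq (fun v => 'C(k - i, v)%:R)) ?ltnS ?leq_subr //.
    by rewrite addrC -natrD polyC_natr.
  (* The ones of the last column of [hptQ] select 0 < v < k. The removed term v = k is nonzero only
     for i = 0, whence 2^k - 2 there and 2^(k-i) - 1 below. *)
  transitivity (\sum_(v < k.+1) 'C(k - i, v)%:R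
    - \sum_(v < k.+1) 'C(k - i, v)%:R * (v == 0 :> nat)%N%:R
    - \sum_(v < k.+1) 'C(k - i, v)%:R * (v == k :> nat)%:R : {poly int}).
    rewrite -!sumrB; apply: eq_bigr => v _.
    rewrite mxE valk leq_subr leqNgt lt_kj /=.
    have -> : (0 < k - v <= k - 1)%N = (v != 0 :> nat) && (v != k :> nat).
      have := le_ord v; lia.
    have [v0|_] := eqVneq (v : nat) 0%N; have [vk|_] := eqVneq (v : nat) k => /=.
    - by exfalso; lia.
    - ring.
    - ring.
    - ring.
  rewrite !(sum_mul_eq (fun v => 'C(k - i, v)%:R)) // sum_bin_widen ?ltnS ?leq_subr //.
  rewrite bin0; case: eqP => [->|/eqP i_neq0].
    by rewrite subn0 binn rmorphB rmorphXn rmorph_nat /=; ring.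
  by rewrite bin_small ?rmorphB ?rmorphXn ?rmorph_nat ?rmorph1 /=; [ring | lia].
- rewrite mxE big_ord_recr big_ord_recr /= big1 => [|u _]; last first.
    have lt_uk := ltn_ord u.
    by rewrite mxE /= !Hi ltn_eqF // ltn_eqF ?mul0r // ltnW.
  rewrite !mxE /= !Hi subnn.
  case: (ord_last2P j) => Hj; rewrite !Hj /=.
  + by rewrite add0r; case: eqP => _; rewrite /= ?rmorphB ?rmorph_nat /=; ring.
  + by rewrite gtn_eqF //= rmorphB !rmorph_nat /=; ring.
  + by have -> : (0 < k <= k - 1)%N = false; [lia | ring].
rewrite mxE big_ord_recr big_ord_recr /= big1 => [|u _]; last first.
  have lt_uk := ltn_ord u.
  by rewrite mxE /= !Hi ltn_eqF // ltn_eqF ?mul0r // ltnW.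
rewrite !mxE /= !Hi subnn.
case: (ord_last2P j) => Hj; rewrite !Hj /=.
- by rewrite add0r; case: eqP => _; rewrite /= ?rmorphB ?rmorph_nat /=; ring.
- by rewrite gtn_eqF //= rmorphB !rmorph_nat /=; ring.
by have -> : (0 < k <= k - 1)%N = false; [lia | ring].
Qed.

Lemma char_poly_hptM q k : (0 < k)%N ->
  char_poly (hptM q k) = (-1) ^+ k * \det (hptD q k).
Proof.
move=> k_gt0; have -> : \det (hptD q k) = \det (hptG q k *m hptD q k).
  by rewrite det_mulmx det_hptG mul1r.
(* The order k+2 turns the sign of M - xI into (-1)^(k+2), which cancels (-1)^k. *)
rewrite mulmxDr hptG_P hptG_Q // addrC -opprB -[- (_ - _)]scaleN1r.
rewrite detZ mulrA -exprD.
by rewrite -signr_odd oddD /= negbK addbb mul1r.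
Qed.

(** * Rows rebuilt by structural recursion *)

Notation cell := (nat * vtype)%type.

(** The list [s] is what remains of a row to the right of an element of value [x]. Its last element
    is the right winger, which is not copied but yields the new winger. *)
Fixpoint hpt_sons (q x : nat) (s : seq cell) : seq cell :=
  match s with
  | [::] => [::]
  | [:: y] => [:: ((x + y.1)%N, TypeA); (1%N, TypeB)]
  | y :: s' => ((x + y.1)%N, TypeA) :: nseq (hpt_copies q y.2) (y.1, TypeB)
               ++ hpt_sons q y.1 s'
  end.

Lemma hpt_sons_cons q x y z s :
  hpt_sons q x (y :: z :: s) =
  ((x + y.1)%N, TypeA) :: nseq (hpt_copies q y.2) (y.1, TypeB)
  ++ hpt_sons q y.1 (z :: s).
Proof. by []. Qed.

Lemma hpt_next_sons q x s : (0 < size s)%N ->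
  hpt_next q (x :: s) = (1%N, TypeB) :: hpt_sons q x.1 s.
Proof.
case: s => // y s _; rewrite /hpt_next /=; congr (_ :: _).
elim: s x y => [|z s IHs] x y //=; congr (_ :: _).
rewrite -cats1 -!catA /=; congr (_ ++ _).
rewrite -(IHs y z) /= !subSS !subn0; congr (_ :: _).
(* Shifting the indices by one amounts to dropping the head of the row. *)
rewrite (iotaDl 1 1) -map_comp; congr (_ ++ _); congr flatten.
Qed.

Definition hpt_tail q n : seq cell := iter n (hpt_sons q 1) [:: (1%N, TypeB)].

Lemma hpt_sons_gt0 q x s : (0 < size s)%N -> (0 < size (hpt_sons q x s))%N.
Proof. by case: s => // y [|z s]. Qed.

Lemma hpt_tail_gt0 q n : (0 < size (hpt_tail q n))%N.
Proof. by elim: n => //= n; apply: hpt_sons_gt0. Qed.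

Lemma hpt_rowE q n : hpt_row q n.+1 = (1%N, TypeB) :: hpt_tail q n.
Proof.
elim: n => // n IHn.
by rewrite -[LHS]/(hpt_next q (hpt_row q n.+1)) IHn hpt_next_sons ?hpt_tail_gt0.
Qed.

(** * Edges of a row and their sons *)

Definition hpt_adj (u v : cell) : bool :=
  match u.2, v.2 with
  | TypeA, TypeA => false
  | TypeB, TypeB => u.1 == v.1
  | _, _ => true
  end.

Definition edge_sum (phi : cell -> cell -> int) (x : cell) (s : seq cell) : int :=
  \sum_(p <- zip (x :: s) s) phi p.1 p.2.

Lemma edge_sum_nil phi x : edge_sum phi x [::] = 0.
Proof. by rewrite /edge_sum /= big_nil. Qed.

Lemma edge_sum_cons phi x y s :
  edge_sum phi x (y :: s) = phi x y + edge_sum phi y s.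
Proof. by rewrite /edge_sum /= big_cons. Qed.

Lemma edge_sum_cat phi x s t :
  edge_sum phi x (s ++ t) = edge_sum phi x s + edge_sum phi (last x s) t.
Proof.
elim: s x => [|y s IHs] x; first by rewrite edge_sum_nil add0r.
by rewrite /= !edge_sum_cons IHs addrA.
Qed.

Lemma edge_sum_nseq phi y n : edge_sum phi y (nseq n y) = phi y y *+ n.
Proof.
elim: n => [|n IHn]; first by rewrite edge_sum_nil.
by rewrite /= edge_sum_cons IHn mulrS.
Qed.

Lemma eq_edge_sum_path phi psi x s : path hpt_adj x s ->
  (forall u v, hpt_adj u v -> phi u v = psi u v) ->
  edge_sum phi x s = edge_sum psi x s.
Proof.
move=> + eq_phi; elim: s x => [|y s IHs] x /=; first by rewrite !edge_sum_nil.
by case/andP=> xy ys; rewrite !edge_sum_cons (eq_phi _ _ xy) IHs.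
Qed.

(* Every inner element has two neighbours. *)
Lemma edge_sum_ends (h : cell -> int) x s :
  edge_sum (fun u v => h u + h v) x s
  = h x + 2 * (\sum_(y <- s) h y) - h (last x s).
Proof.
elim: s x => [|y s IHs] x; first by rewrite edge_sum_nil big_nil /=; ring.
by rewrite edge_sum_cons IHs big_cons /=; ring.
Qed.

(** Invariant of a row stripped of its left winger, which reappears as the start of the path. *)
Definition hpt_wf (s : seq cell) : Prop :=
  [/\ (0 < size s)%N, path hpt_adj (1%N, TypeB) s &
      last (1%N, TypeB) s = (1%N, TypeB)].

Lemma path_nseq_adj y n s :
  path hpt_adj (y, TypeB) (nseq n (y, TypeB) ++ s) = path hpt_adj (y, TypeB) s.
Proof. by elim: n => //= n ->; rewrite /hpt_adj /= eqxx. Qed.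

Lemma last_nseq_eq (T : Type) (y : T) n : last y (nseq n y) = y.
Proof. by elim: n. Qed.

Lemma hpt_copies_gt0 q t : (5 <= q)%N -> (0 < hpt_copies q t)%N.
Proof. by case: t => /=; lia. Qed.

(** As q >= 5, every inner element has at least one copy, of type B, which separates the
    neighbouring sums of type A. *)
Lemma path_hpt_sons q x s : (5 <= q)%N -> (last x s).1 = 1%N ->
  path hpt_adj (x.1, TypeB) (hpt_sons q x.1 s).
Proof.
move=> q_ge5; elim: s x => [|y [|z s] IHs] x //= last1.
have := hpt_copies_gt0 y.2 q_ge5; case: hpt_copies => // n _ /=.
by rewrite path_nseq_adj; apply: (IHs y).
Qed.

Lemma last_hpt_sons q x s : (0 < size s)%N ->
  last (1%N, TypeB) (hpt_sons q x s) = (1%N, TypeB).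
Proof.
case: s => // y s _; elim: s x y => [|z s IHs] x y //.
rewrite hpt_sons_cons last_cons last_cat -(IHs y.1 z).
by case: (hpt_sons q y.1 _) (@hpt_sons_gt0 q y.1 (z :: s) isT).
Qed.

Lemma hpt_wf_sons q s : (5 <= q)%N -> hpt_wf s -> hpt_wf (hpt_sons q 1 s).
Proof.
move=> q_ge5 [s_gt0 _ last_s]; split; first exact: hpt_sons_gt0.
  by apply: (@path_hpt_sons q (1%N, TypeB)); rewrite ?last_s.
exact: last_hpt_sons.
Qed.

Lemma hpt_wf_tail q n : (5 <= q)%N -> hpt_wf (hpt_tail q n).
Proof. by move=> q_ge5; elim: n => //= n; apply: hpt_wf_sons. Qed.

(** The son of an edge lies on two new edges, and a run of copies contains one edge fewer than
    copies, whence [.-1]. The right winger has no such run, so its [kappa] is removed; its value 1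
    makes the new winger its only copy. *)
Lemma edge_sum_sons q (phi : cell -> cell -> int) x s :
    (5 <= q)%N -> (0 < size s)%N -> (last x s).1 = 1%N ->
  let kappa y := phi (y.1, TypeB) (y.1, TypeB) *+ (hpt_copies q y.2).-1 in
  edge_sum phi (x.1, TypeB) (hpt_sons q x.1 s) =
  edge_sum (fun u v => phi (u.1, TypeB) ((u.1 + v.1)%N, TypeA)
                     + phi ((u.1 + v.1)%N, TypeA) (v.1, TypeB)) x s
  + \sum_(y <- s) kappa y - kappa (last x s).
Proof.
move=> q_ge5 + + kappa; case: s => // y s _; elim: s x y => [|z s IHs] x y last1.
  rewrite /= !edge_sum_cons !edge_sum_nil big_seq1 [y.1]last1; ring.
have := hpt_copies_gt0 y.2 q_ge5; case Ey: hpt_copies => [//|n] _.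
rewrite hpt_sons_cons Ey edge_sum_cons edge_sum_cat [nseq _ _]/= edge_sum_cons.
rewrite edge_sum_nseq last_cons last_nseq_eq.
rewrite IHs // (edge_sum_cons _ x) [\sum_(_ <- [:: y, z & s]) _]big_cons last_cons.
have -> : kappa y = phi (y.1, TypeB) (y.1, TypeB) *+ n by rewrite /kappa Ey.
ring.
Qed.

(** Sons of type A do not count; the copies wrongly attributed to the right winger are traded for
    the new winger. *)
Lemma sum_hpt_sons q (h : cell -> int) x s :
    (0 < size s)%N -> (forall a, h (a, TypeA) = 0) ->
  \sum_(y <- hpt_sons q x s) h y =
  \sum_(y <- s) h (y.1, TypeB) *+ hpt_copies q y.2
  - h ((last (x, TypeB) s).1, TypeB) *+ hpt_copies q (last (x, TypeB) s).2
  + h (1%N, TypeB).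
Proof.
move=> + hA; case: s => // y s _; elim: s x y => [|z s IHs] x y.
  by rewrite /= !big_cons !big_nil hA; ring.
rewrite hpt_sons_cons big_cons big_cat hA /= -/(hpt_sons q y.1 (z :: s)).
rewrite IHs.
rewrite big_nseq -mulr_natl iter_addr_0 -mulr_natl.
by rewrite [\sum_(_ <- [:: y, z & s]) _]big_cons /= -mulr_natl; ring.
Qed.

(** * Powers along edges *)

Definition powA k (u : cell) : int := if u.2 is TypeA then u.1%:R ^+ k else 0.
Definition powB k (u : cell) : int := if u.2 is TypeB then u.1%:R ^+ k else 0.

Definition edge_pow k j (u v : cell) : int :=
  match u.2, v.2 with
  | TypeA, TypeB => u.1%:R ^+ (k - j) * v.1%:R ^+ j
  | TypeB, TypeA => v.1%:R ^+ (k - j) * u.1%:R ^+ j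
  | _, _ => 0
  end.

Definition flat_pow k (u v : cell) : int :=
  match u.2, v.2 with
  | TypeB, TypeB => u.1%:R ^+ k
  | _, _ => 0
  end.

Lemma mul_exprD_widen (R : comNzRingType) (x y : R) i k : (i <= k)%N ->
  (x + y) ^+ (k - i) * x ^+ i =
  \sum_(v < k.+1) 'C(k - i, v)%:R * (x ^+ (k - v) * y ^+ v).
Proof.
move=> le_ik; rewrite (@exprDn_widen _ _ _ _ k.+1) ?ltnS ?leq_subr // mulr_suml.
apply: eq_bigr => v _; have [le_v|lt_v] := leqP v (k - i); last first.
  by rewrite bin_small // mulr0n !mul0r.
have -> : (k - v = k - i - v + i)%N by lia.
by rewrite exprD -mulr_natl; ring.
Qed.

Lemma mul_exprD_rev (R : comNzRingType) (x y : R) i k : (i <= k)%N ->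
  (x + y) ^+ (k - i) * y ^+ i =
  \sum_(v < k.+1) 'C(k - i, k - v)%:R * (x ^+ (k - v) * y ^+ v).
Proof.
move=> le_ik; rewrite addrC mul_exprD_widen // (reindex_inj rev_ord_inj).
apply: eq_bigr => v _ /=; have le_vk : (v <= k)%N by rewrite -ltnS.
by rewrite subSS subKn // [X in _ * X]mulrC.
Qed.

(** On a mixed edge the two terms are the expansions of (x+y)^(k-i) x^i and (x+y)^(k-i) y^i. On an
    edge joining equal elements both are (2x)^(k-i) x^i. *)
Lemma edge_pow_sons k i (u v : cell) : (i <= k)%N -> hpt_adj u v ->
  edge_pow k i (u.1, TypeB) ((u.1 + v.1)%N, TypeA)
  + edge_pow k i ((u.1 + v.1)%N, TypeA) (v.1, TypeB)
  = \sum_(j < k.+1) ('C(k - i, j) + 'C(k - i, k - j))%:R * edge_pow k j u v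
    + 2 ^+ (k - i).+1 * flat_pow k u v.
Proof.
move=> le_ik; case: u v => [x [|]] [y [|]] //= adj_uv;
  rewrite /edge_pow /flat_pow /= natrD.
- rewrite mulr0 addr0 mul_exprD_widen // mul_exprD_rev // -big_split.
  by apply: eq_bigr => j _ /=; rewrite natrD mulrDl.
- rewrite mulr0 addr0 addrC [X in X ^+ _ * _ + X ^+ _ * _]addrC.
  rewrite mul_exprD_widen // mul_exprD_rev // -big_split.
  by apply: eq_bigr => j _ /=; rewrite natrD mulrDl.
rewrite big1 ?add0r => [|j _]; last by rewrite mulr0.
move/eqP: adj_uv => /= ->.
have -> : y%:R + y%:R = 2 * y%:R :> int by ring.
rewrite exprMn exprS.
by have -> : y%:R ^+ k = y%:R ^+ (k - i) * y%:R ^+ i :> int;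
  [rewrite -exprD subnK | ring].
Qed.

Lemma edge_sum_linear n (c : 'I_n -> int) phi d psi x s :
  edge_sum (fun u v => \sum_(j < n) c j * phi j u v + d * psi u v) x s
  = \sum_(j < n) c j * edge_sum (phi j) x s + d * edge_sum psi x s.
Proof.
rewrite /edge_sum big_split exchange_big -mulr_sumr /=; congr (_ + _).
by apply: eq_bigr => j _; rewrite mulr_sumr.
Qed.

(** * The state vector and its affine evolution *)

Section State.
Variables (q k : nat) (q_ge5 : (5 <= q)%N) (k_gt0 : (0 < k)%N).

Let E j s := edge_sum (edge_pow k j) (1%N, TypeB) s.
Let F s := edge_sum (flat_pow k) (1%N, TypeB) s.
Let B s := \sum_(y <- s) powB k y.
Let A s := \sum_(y <- s) powA k y.

(** Each element of type A lies on two edges, both mixed, because the wingers are of type B. *)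
Lemma edge_pow_0 s : hpt_wf s -> E 0 s = 2 * A s.
Proof.
case=> _ wf_s last_s.
transitivity (edge_sum (fun u v => powA k u + powA k v) (1%N, TypeB) s).
  apply: eq_edge_sum_path => // -[x [|]] [y [|]] //= _;
  by rewrite /edge_pow /powA /= ?subn0 ?expr0; ring.
by rewrite edge_sum_ends last_s /powA /A; ring.
Qed.

(** Each inner element of type B is met by two edges, each winger by one; [B s] omits the left
    winger, which compensates for the right one. *)
Lemma edge_pow_k s : hpt_wf s -> E k s + 2 * F s = 2 * B s.
Proof.
case=> _ wf_s last_s.
have -> : E k s + 2 * F s =
    edge_sum (fun u v => edge_pow k k u v + 2 * flat_pow k u v) (1%N, TypeB) s.
  by rewrite /E /F /edge_sum mulr_sumr -big_split.
rewrite (eq_edge_sum_path (psi := fun u v => powB k u + powB k v) wf_s).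
  by rewrite edge_sum_ends last_s /powB /B; ring.
move=> [x [|]] [y [|]] //= adj;
  rewrite /edge_pow /flat_pow /powB /= ?subnn ?expr0; try ring.
by move/eqP: adj => /= ->; ring.
Qed.

Lemma edge_pow_step i s : (i < k)%N -> hpt_wf s ->
  E i (hpt_sons q 1 s) =
  \sum_(j < k.+1) ('C(k - i, j) + 'C(k - i, k - j))%:R * E j s
  + 2 ^+ (k - i).+1 * F s.
Proof.
move=> lt_ik [s_gt0 wf_s last_s]; rewrite /E /F.
rewrite (@edge_sum_sons q _ (1%N, TypeB)) ?last_s //.
rewrite big1 => [|y _]; last by rewrite mul0rn.
rewrite mul0rn subr0 addr0 -edge_sum_linear; apply: eq_edge_sum_path => // u v.
exact/edge_pow_sons/ltnW.
Qed.

(** The case d = 0 counts copies and d = 1 the edges between them; the bound on d prevents truncated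
    subtraction. *)
Lemma hpt_copies_sum (d : nat) s : (d <= q - 4)%N ->
  \sum_(y <- s) y.1%:R ^+ k *+ (hpt_copies q y.2 - d)
  = (q%:R - 4 - d%:R) * A s + (q%:R - 3 - d%:R) * B s.
Proof.
move=> le_d; rewrite !mulr_sumr -big_split; apply: eq_bigr => -[x [|]] _ /=;
  rewrite /powA /powB /= -mulr_natr !natrB; (try lia); ring.
Qed.

(** The constant is -(q-3) + 1: the right winger loses its fictitious copies and the new winger is
    added. *)
Lemma powB_step s : hpt_wf s ->
  B (hpt_sons q 1 s) = (q%:R - 4) * A s + (q%:R - 3) * B s - (q%:R - 4).
Proof.
have sum_copies : \sum_(y <- s) y.1%:R ^+ k *+ hpt_copies q y.2
    = (q%:R - 4) * A s + (q%:R - 3) * B s.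
  have := @hpt_copies_sum 0 s (leq0n _); rewrite !subr0 => <-.
  by apply: eq_bigr => y _; rewrite subn0.
case=> s_gt0 wf_s last_s; rewrite /B sum_hpt_sons // last_s /powB /= sum_copies.
by rewrite expr1n natrB; [ring | lia].
Qed.

(** The constant removes the q-4 edges that q-3 copies of the right winger would have formed. *)
Lemma flat_pow_step s : hpt_wf s ->
  F (hpt_sons q 1 s) = (q%:R - 5) * A s + (q%:R - 4) * B s - (q%:R - 4).
Proof.
case=> s_gt0 wf_s last_s; rewrite /F (@edge_sum_sons q _ (1%N, TypeB)) ?last_s //.
rewrite [edge_sum _ _ _]big1 ?add0r => [|p _]; last by rewrite /flat_pow addr0.
have := @hpt_copies_sum 1 s; under eq_bigr => y _ do rewrite subn1.
move=> ->; last lia.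
by rewrite /flat_pow /= expr1n -subn1 !natrB; (try lia); ring.
Qed.

Definition hpt_state s : 'cV[int]_k.+2 :=
  (* the 1 stands for the left winger, which s omits *)
  \col_i if (i < k)%N then E i s else if (i == k :> nat) then 2 * (1 + B s)
         else 2 * F s.

(** In row i < k this is -2 times the entry of [hptM] in column k, because entry k of the state
    exceeds 2B by 2. The other two rows add the winger corrections to this effect. *)
Definition hpt_shift : 'cV[int]_k.+2 :=
  \col_i if (i < k)%N then - (2 * ('C(k - i, k) + 1)%:R)
         else 4 * (4 - q%:R).

Lemma hpt_state_step s : hpt_wf s ->
  hpt_state (hpt_sons q 1 s) = hptM q k *m hpt_state s + hpt_shift.
Proof.
move=> wf_s; apply/matrixP => i j; rewrite !mxE !big_ord_recr /= !mxE /= !(ord_cmpP k).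
have Ek := edge_pow_k wf_s; have E0 := edge_pow_0 wf_s.
case: (ord_last2P i) => Hi; rewrite !Hi.
- rewrite edge_pow_step ?Hi //. 
  rewrite big_ord_recr /= subnn bin0.
  (* This substitution lowers the coefficient of 2F from 2^(k-i) by the entry in column k, which is
     2 for i = 0 and 1 otherwise: this is the last column of [hptM]. *)
  have -> : E k s = 2 * B s - 2 * F s by rewrite -Ek addrK.
  under [in RHS]eq_bigr => v _.
    rewrite !mxE Hi /= ltnW // ltn_ord; over.
  rewrite -!addrA; congr (_ + _).
  case: eqP => [->|/eqP i_neq0].
    rewrite subn0 binn exprS; ring.
  rewrite [X in (X + 1)%:R]bin_small; last lia.
  rewrite exprS; ring.
(* In rows k and k+1 only columns 0 and k of [hptM] matter, and [E0] identifies entry 0 of the state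
   with 2A. *)
- rewrite powB_step // (bigD1 (Ordinal k_gt0)) //= big1 => [|v /negPf]; last first.
    rewrite -val_eqE /= => v_neq0; have lt_vk := ltn_ord v.
    by rewrite !mxE /= !Hi v_neq0 (ltn_eqF lt_vk) mul0r.
  rewrite !mxE /= !Hi /= k_gt0 E0 gtn_eqF //; ring.
rewrite flat_pow_step // (bigD1 (Ordinal k_gt0)) //= big1 => [|v /negPf]; last first.
  rewrite -val_eqE /= => v_neq0; have lt_vk := ltn_ord v.
  by rewrite !mxE /= !Hi v_neq0 (ltn_eqF lt_vk) mul0r.
by rewrite !mxE /= !Hi /= k_gt0 E0 gtn_eqF //; ring.
Qed.

Lemma hpt_psum_state n (i0 : 'I_k.+2 := ord0) (ik : 'I_k.+2 := lift ord_max ord_max) :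
  2 * (hpt_psum q k n.+1)%:R =
  hpt_state (hpt_tail q n) i0 ord0 + hpt_state (hpt_tail q n) ik ord0 :> int.
Proof.
rewrite !mxE /= /bump !(ord_cmpP k) k_gt0 edge_pow_0 /=; last exact: hpt_wf_tail.
rewrite /hpt_psum hpt_rowE big_cons exp1n natrD natr_sum.
have -> : \sum_(y <- hpt_tail q n) (y.1 ^ k)%:R
    = A (hpt_tail q n) + B (hpt_tail q n) :> int.
  rewrite -big_split; apply: eq_bigr => -[x [|]] _;
  by rewrite /powA /powB /= natrX ?addr0 ?add0r.
ring.
Qed.
End State.

(** * The determinant formula and the scalar recurrence *)

Theorem mainTheorem3 (q k : nat) (hq : (5 <= q)%N) (hk : (2 <= k)%N) :
  char_poly (hptM q k) = (-1) ^+ k * \det (hptD q k) /\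
  let p : {poly int} := ('X - 1) * (-1) ^+ k * \det (hptD q k) in
  [/\ p \is monic,
      size p = (k + 4)%N &
      forall n : nat, (1 <= n)%N ->
        \sum_(i < k + 4) p`_i * (hpt_psum q k (n + i))%:R = 0].
Proof.
have k_gt0 := ltnW hk; have charE := char_poly_hptM q k_gt0.
split=> // p; have {p}-> : p = ('X - 1) * char_poly (hptM q k).
  by rewrite charE mulrA.
have monic_p : ('X - 1) * char_poly (hptM q k) \is monic.
  by rewrite monicMl ?char_poly_monic // monicXsubC.
have size_p : size (('X - 1) * char_poly (hptM q k)) = (k + 4)%N.
  rewrite size_monicM ?monicXsubC ?monic_neq0 ?char_poly_monic //.
  by rewrite size_XsubC size_char_poly; lia.
(* Row n+1 is encoded by [hpt_tail q n], hence the start of the recurrence at row 1. *)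
split=> // -[//|n] _; set p := _ * _.
pose V m := hpt_state k (hpt_tail q m).
have sumV0 : \sum_(i < k + 4) p`_i *: V (n + i)%N = 0.
  rewrite -size_p (char_poly_affine_rec (c := hpt_shift q k)) // => m.
  by rewrite -hpt_state_step //; apply: hpt_wf_tail.
(* Twice the power sum is the sum of entries 0 and k of the state, so the vector relation is read in
   these two entries. *)
apply: (@mulfI _ 2) => //; rewrite mulr0 mulr_sumr.
transitivity (\sum_(i < k + 4) ((p`_i *: V (n + i)%N) ord0 ord0
    + (p`_i *: V (n + i)%N) (lift ord_max ord_max) ord0)).
  apply: eq_bigr => i _; rewrite mulrCA addSn hpt_psum_state // mulrDr.
  by congr (_ + _); rewrite [RHS]mxE.
by rewrite big_split /= -!summxE sumV0 !mxE addr0.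
Qed.
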